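(* Let $a<b$ be positive integers with $a\neq1$ odd and $b$ even. Then there is no infinite smooth word over $\{a,b\}$ that is an infinite Lyndon word.
   Context: Words over $\{a,b\}$ are compared lexicographically with $a<b$. For a word $w$ over $\{a,b\}$ written as maximal blocks $\alpha_0^{i_0}\alpha_1^{i_1}\cdots$ ($\alpha_{k+1}\ne\alpha_k$, $i_k\ge1$), $\Delta(w)=i_0i_1\cdots$. An infinite word $w\in\{a,b\}^\omega$ is smooth if $\Delta^k(w)\in\{a,b\}^\omega$ for all $k\ge0$. An infinite Lyndon word is an infinite word strictly smaller than each of its proper suffixes. *)

(* Defs.v *)
From mathcomp Require Import all_boot.

Set Implicit Arguments.
Unset Strict Implicit.
Unset Printing Implicit Defensive.

(* The letters of words are natural numbers, so that the run-length encoding of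
   a word is again a word. *)
Definition word := nat -> nat.

Definition word_over (a b : nat) (w : word) : Prop :=
  forall i, w i \in [:: a; b].

(* [is_Delta w v] : w = alpha_0^(v 0) alpha_1^(v 1) ... with maximal blocks, i.e.
   Delta(w) is the infinite word v. It holds for no v when w is eventually
   constant, since w then has only finitely many blocks. *)
Definition is_Delta (w v : word) : Prop :=
  exists alpha : nat -> nat,
    [/\ forall k, 1 <= v k,
        forall k, alpha k.+1 != alpha k
      & forall k j, j < v k -> w (\sum_(l < k) v l + j) = alpha k].

(* [is_Delta_iter k w v] : Delta^k(w) is defined and is the infinite word v. *)
Fixpoint is_Delta_iter (k : nat) (w v : word) : Prop :=
  if k is k'.+1 then exists2 u : word, is_Delta_iter k' w u & is_Delta u v
  else v =1 w.

Definition smooth (a b : nat) (w : word) : Prop :=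
  forall k, exists2 v : word, is_Delta_iter k w v & word_over a b v.

Definition lex_lt (u v : word) : Prop :=
  exists2 n, (forall i, i < n -> u i = v i) & u n < v n.

Definition suffix_from (n : nat) (w : word) : word := fun i => w (n + i).

Definition infinite_Lyndon (w : word) : Prop :=
  forall n, 0 < n -> lex_lt w (suffix_from n w).

(* Delta is single-valued, so that [is_Delta] is the graph of a partial
   function. *)
Lemma is_Delta_fun (w w' v v' : word) :
  w =1 w' -> is_Delta w v -> is_Delta w' v' -> v =1 v'.
Proof.
have aux (u u' x x' : word) k : u =1 u' -> is_Delta u x -> is_Delta u' x' ->
    \sum_(l < k) x l = \sum_(l < k) x' l -> x' k <= x k.
  move=> uu' [al [x_gt0 alN alE]] [al' [x'_gt0 alN' alE']] Ek.
  rewrite leqNgt; apply/negP => lt_x.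
  have e0 := alE k 0 (x_gt0 k); have e0' := alE' k 0 (x'_gt0 k).
  have e1 := alE k.+1 0 (x_gt0 k.+1); have e1' := alE' k (x k) lt_x.
  rewrite big_ord_recr /= addn0 in e1.
  have /eqP[] := alN k.
  by rewrite -e1 -e0 !uu' Ek e1' e0'.
move=> ww' wv wv'; elim/ltn_ind => k IHk.
have Ek : \sum_(l < k) v l = \sum_(l < k) v' l.
  by apply: eq_bigr => l _; apply: IHk.
by apply/eqP; rewrite eqn_leq (aux _ _ _ _ k (fsym ww') wv' wv) // (aux _ _ _ _ k ww' wv wv').
Qed.

Lemma is_Delta_iter_fun (k : nat) (w v v' : word) :
  is_Delta_iter k w v -> is_Delta_iter k w v' -> v =1 v'.
Proof.
elim: k v v' => [|k IHk] v v' /=; first by move=> vw v'w i; rewrite vw v'w.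
by move=> [u wu uv] [u' wu' u'v']; apply: is_Delta_fun uv u'v'; apply: IHk.
Qed.

(* Main.v *)
Require Import Defs.
From mathcomp Require Import all_boot zify.

(** Let [u], [v], [t] be the first three iterated derivatives of a smooth
    Lyndon word [w]. The blocks of the letter [a] in [w] are those of even
    index. As [u] has no isolated letters, it has a [b] at an even position, so
    minimality forces [w] to start with [a^b b^b]. Hence no block [a^b] of [w]
    is followed by [b^a], i.e. every block of [b] in [u] ends at an odd
    position. Since [a] is odd and [b] even, this means that [v] has the form
    [x0 x1 x1 x2 x2 ...]; so all blocks of [v] but the first have even length,
    i.e. length [b], and [t] is eventually constant: it has no derivative. *)

Lemma is_Delta_iter_over (a b k : nat) (w v : word) :
  smooth a b w -> is_Delta_iter k w v -> word_over a b v.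
Proof.
move=> sm wv i; have [v' wv' v'_ab] := sm k.
by rewrite (is_Delta_iter_fun wv wv').
Qed.

Lemma lex_ltN (x y : word) (n : nat) :
  (forall i, i < n -> x i = y i) -> y n < x n -> ~ lex_lt x y.
Proof.
move=> eq_xy lt_yx [m eq_m lt_m].
case: (ltngtP m n) => [lt_mn|lt_nm|eq_mn].
- by rewrite eq_xy ?ltnn in lt_m.
- by rewrite eq_m ?ltnn in lt_yx.
- by move: lt_m; rewrite eq_mn ltnNge (ltnW lt_yx).
Qed.

(** Here [v] is the word of block lengths, the derivative of the word whose blocks are located. *)
Definition block_start (v : word) (k : nat) : nat := \sum_(l < k) v l.

Lemma block_startS (v : word) (k : nat) :
  block_start v k.+1 = block_start v k + v k.
Proof. by rewrite /block_start big_ord_recr. Qed.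

Lemma block_start_gt0 (v : word) (k : nat) :
  (forall i, 0 < v i) -> 0 < k -> 0 < block_start v k.
Proof. by case: k => // k v_gt0 _; rewrite block_startS addn_gt0 v_gt0 orbT. Qed.

Lemma is_DeltaP (w v : word) : is_Delta w v ->
  exists alpha : nat -> nat,
    [/\ forall k, 0 < v k,
        forall k, alpha k.+1 != alpha k,
        forall k j, j < v k -> w (block_start v k + j) = alpha k,
        forall k, w (block_start v k) = alpha k
      & forall k, w (block_start v k.+1).-1 = alpha k].
Proof.
move=> [al [v_gt0 alN alE]]; exists al; split=> // k.
  by rewrite -[block_start v k]addn0; apply: alE.
have vk := v_gt0 k; rewrite block_startS.
have -> : (block_start v k + v k).-1 = block_start v k + (v k).-1 by lia.
by apply: alE; lia.
Qed.

Lemma alternate_parity (a b : nat) (al : nat -> nat) :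
  (forall k, al k \in [:: a; b]) ->
  (forall k, al k.+1 != al k) ->
  al 0 = a -> forall k, al k = if odd k then b else a.
Proof.
move=> al_ab alN al0; elim=> [|k IHk] //=.
by move: (alN k) (al_ab k.+1); rewrite IHk !inE; case: (odd k) => /= /eqP ? /orP[/eqP|/eqP].
Qed.

(** Every block but the first starts at a positive position and so has letter [c]; blocks 1 and 2
    would then not alternate. *)
Lemma no_Delta_eventually_constant (w v : word) (c : nat) :
  (forall k, w k.+1 = c) -> ~ is_Delta w v.
Proof.
move=> wc /is_DeltaP[al [v_gt0 alN _ alE _]].
have al_c k : al k.+1 = c.
  by rewrite -alE -[block_start _ _]prednK ?wc // block_start_gt0.
by have := alN 1; rewrite !al_c eqxx.
Qed.

Section OddEvenAlphabet.

Variables a b : nat.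
Hypotheses (lt_ab : a < b) (a_gt1 : 1 < a) (a_odd : odd a) (b_even : ~~ odd b).

Lemma letter_ge (x : word) (k : nat) : word_over a b x -> a <= x k.
Proof. by move/(_ k); rewrite !inE => /orP[]/eqP-> //; apply: ltnW. Qed.

Lemma odd_letter (x : word) (k : nat) :
  word_over a b x -> x k = if odd (x k) then a else b.
Proof. by move/(_ k); rewrite !inE => /orP[]/eqP->; rewrite ?a_odd ?(negbTE b_even). Qed.

Lemma block_letter_over (w v : word) (al : nat -> nat) :
  word_over a b w -> (forall k, w (block_start v k) = al k) ->
  forall k, al k \in [:: a; b].
Proof. by move=> w_ab alE k; rewrite -alE. Qed.

(** One of the first two blocks consists of [b]; having length at least [a > 1], it covers two
    consecutive positions, one of them even. *)
Lemma exists_even_position_b (u v : word) :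
  word_over a b u -> word_over a b v -> is_Delta u v ->
  exists2 k, ~~ odd k & u k = b.
Proof.
move=> u_ab v_ab /is_DeltaP[al [v_gt0 alN alE alE0 _]].
have [k alk] : exists k, al k = b.
  have al_ab := block_letter_over _ _ _ u_ab alE0.
  move: (alN 0) (al_ab 0) (al_ab 1); rewrite !inE.
  move=> /eqP ne /orP[]/eqP e0 /orP[]/eqP e1; try by exists 0.
    by rewrite e0 e1 in ne.
  by exists 1.
have vk := letter_ge v k v_ab.
case: (boolP (odd (block_start v k))) => odd_k.
  by exists (block_start v k + 1); rewrite ?alE //; lia.
by exists (block_start v k); rewrite ?alE0.
Qed.

Section LyndonBlocks.

Variables w u v : word.
Hypotheses (w_ab : word_over a b w) (u_ab : word_over a b u).
Hypotheses (v_ab : word_over a b v) (wu : is_Delta w u) (uv : is_Delta u v).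
Hypothesis w_lyndon : infinite_Lyndon w.

Lemma lyndon_blocks (k j : nat) :
  j < u k -> w (block_start u k + j) = if odd k then b else a.
Proof.
have [al [u_gt0 alN alE alE0 _]] := is_DeltaP _ _ wu.
have al_ab := block_letter_over _ _ _ w_ab alE0.
have w0 : w 0 = al 0 by rewrite -alE0 /block_start big_ord0.
(* Otherwise the suffix starting at block 1 begins with [a] while [w] begins with [b]. *)
suff al0 : al 0 = a.
  by move=> ?; rewrite alE // (alternate_parity a b al).
have := al_ab 0; rewrite !inE => /orP[/eqP //|/eqP al0].
have al1 : al 1 = a.
  by move: (alN 0) (al_ab 1); rewrite al0 !inE => /negbTE-> /orP[/eqP|].
have := w_lyndon _ (block_start_gt0 _ 1 u_gt0 isT).
case/(lex_ltN _ _ 0) => //.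
by rewrite /suffix_from addn0 alE0 al1 w0 al0.
Qed.

Let u_gt0 k : 0 < u k.
Proof. by have := letter_ge u k u_ab; lia. Qed.

Let lyndon_first_block j : j < u 0 -> w j = a.
Proof. by have := lyndon_blocks 0 j; rewrite /block_start big_ord0; apply. Qed.

Lemma lyndon_first_block_length : u 0 = b.
Proof.
have [k even_k uk] := exists_even_position_b _ _ u_ab v_ab uv.
have := u_ab 0; rewrite !inE => /orP[/eqP u0|/eqP //].
have k_gt0 : 0 < k.
  by case: k uk {even_k} => // uk; lia.
have := w_lyndon _ (block_start_gt0 _ k u_gt0 k_gt0).
have wk j : j < b -> suffix_from (block_start u k) w j = a.
  by move=> lt_jb; rewrite /suffix_from lyndon_blocks ?uk // (negbTE even_k).
(* If [u 0 = a], then at position [a] the word [w] enters its first block of [b], while the suffix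
   is still inside a block of [b] letters [a]. *)
case/(lex_ltN _ _ a) => [i lt_ia|].
  by rewrite wk ?lyndon_first_block ?u0 //; lia.
rewrite wk //; have := lyndon_blocks 1 0 (u_gt0 1).
by rewrite block_startS /block_start big_ord0 u0 addn0 => ->.
Qed.

(** Since [v 0 >= a > 1], positions 0 and 1 lie in the same block of [u]. *)
Lemma lyndon_second_block_length : u 1 = b.
Proof.
have [al [_ _ alE _ _]] := is_DeltaP _ _ uv.
have v0 := letter_ge v 0 v_ab.
have E j : j < v 0 -> u j = al 0.
  by move=> ?; rewrite -(alE 0 j) // /block_start big_ord0.
by rewrite -lyndon_first_block_length !E //; lia.
Qed.

Lemma lyndon_even_position_b (n : nat) : ~~ odd n -> u n = b -> u n.+1 = b.
Proof.
move=> even_n un; have := u_ab n.+1; rewrite !inE => /orP[/eqP un1|/eqP //].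
have u0 := lyndon_first_block_length; have u1 := lyndon_second_block_length.
have n_gt0 : 0 < n by case: n un1 {even_n un} => // un1; lia.
have := w_lyndon _ (block_start_gt0 _ n u_gt0 n_gt0).
have w1 j : j < b -> w (b + j) = b.
  move=> ?; have := lyndon_blocks 1 j; rewrite u1 block_startS.
  by rewrite /block_start big_ord0 u0; apply.
have wn1 j : j < a -> suffix_from (block_start u n) w (b + j) = b.
  move=> ?; have := lyndon_blocks n.+1 j.
  by rewrite un1 block_startS un /= even_n /suffix_from addnA; apply.
(* The suffix starts with [a^b b^a a] and [w] with [a^b b^b]; as [a < b], they first differ at
   position [b + a], in favour of the suffix. *)
case/(lex_ltN _ _ (b + a)) => [i lt_i|].
  case: (ltnP i b) => [lt_ib|le_bi].
    by rewrite lyndon_first_block ?u0 // /suffix_from lyndon_blocks ?un // (negbTE even_n).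
  by rewrite -(subnKC le_bi) w1 ?wn1 //; lia.
rewrite w1 //; have := lyndon_blocks n.+2 0 (u_gt0 _).
by rewrite !block_startS un un1 /= negbK (negbTE even_n) addn0 -addnA /suffix_from => ->.
Qed.

Lemma lyndon_second_derivative_pairs (k : nat) : odd k -> v k = v k.+1.
Proof.
move=> odd_k; have [al [v_gt0 alN alE alE0 alE1]] := is_DeltaP _ _ uv.
have al_ba m : al m = if odd m then a else b.
  apply: alternate_parity => // [i|].
    by rewrite -alE0 !inE orbC; have := u_ab (block_start v i); rewrite !inE.
  by rewrite -alE0 /block_start big_ord0 lyndon_first_block_length.
(* Blocks of odd index in [u] consist of [a]. If one started at an odd position, the [b] just before
   it would sit at an even position and force another [b]. *)
have even_start m : odd m -> ~~ odd (block_start v m).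
  case: m => //= m even_m; apply/negP => odd_S.
  have S_gt0 := block_start_gt0 _ m.+1 v_gt0 isT.
  have := lyndon_even_position_b (block_start v m.+1).-1.
  rewrite prednK // alE0 alE1 !al_ba /= (negbTE even_m) /=.
  by move=> H; have := H _ (erefl _); lia.
(* Blocks [k] and [k.+2] both start at even positions, so [v k + v k.+1] is even; parity determines
   the letter. *)
have := even_start k odd_k; have := even_start k.+2.
rewrite /= negbK odd_k => /(_ isT); rewrite !block_startS !oddD.
rewrite (odd_letter v k v_ab) (odd_letter v k.+1 v_ab).
by case: (odd (v k)); case: (odd (v k.+1)); case: (odd (block_start v k));
  rewrite ?a_odd ?(negbTE b_even).
Qed.

End LyndonBlocks.

Lemma paired_word_Delta (v t : word) :
  word_over a b t -> is_Delta v t -> (forall k, odd k -> v k = v k.+1) ->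
  forall k, t k.+1 = b.
Proof.
move=> t_ab /is_DeltaP[al [t_gt0 alN _ alE0 alE1]] v_pairs.
(* No block boundary of [v] separates an odd position from the next one. Hence the length of every
   later block, a difference of two odd starts, is even. *)
have odd_start k : odd (block_start t k.+1).
  apply/negPn/negP => even_S.
  have S_gt0 := block_start_gt0 _ k.+1 t_gt0 isT.
  have := v_pairs (block_start t k.+1).-1; rewrite prednK // alE0 alE1.
  by move=> H; have := alN k; rewrite H ?eqxx //; lia.
move=> k; have := odd_start k.+1; rewrite block_startS oddD odd_start /=.
by rewrite (odd_letter t k.+1 t_ab); case: (odd (t k.+1)); rewrite ?a_odd.
Qed.

End OddEvenAlphabet.

Theorem theorem30 (a b : nat) (a_gt0 : 0 < a) (lt_ab : a < b)
    (a_neq1 : a <> 1) (a_odd : odd a) (b_even : ~~ odd b) :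
  ~ exists w : word, smooth a b w /\ infinite_Lyndon w.
Proof.
have a_gt1 : 1 < a by lia.
move=> [w [w_smooth w_lyndon]].
have [z wz _] := w_smooth 4.
have [t wt tz] := wz; have [v wv vt] := wt; have [u wu uv] := wv.
have [w0 ww0 w0u] := wu.
have over k x : is_Delta_iter k w x -> word_over a b x by apply: is_Delta_iter_over.
(* [w0] is only pointwise equal to [w], so the Lyndon property has to be transported. *)
have {}w0_lyndon : infinite_Lyndon w0.
  move=> n n_gt0; have [m eq_m lt_m] := w_lyndon n n_gt0.
  by exists m => [i /eq_m|]; rewrite /suffix_from !ww0.
have v_pairs := lyndon_second_derivative_pairs a b lt_ab a_gt1 a_odd b_even w0 u v
  (over 0 _ ww0) (over 1 _ wu) (over 2 _ wv) w0u uv w0_lyndon.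
apply: (no_Delta_eventually_constant t z b _ tz).
by apply: (paired_word_Delta a b) (over 3 _ wt) vt v_pairs.
Qed.
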